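(* Let $N,s\ge 1$ be integers, let $S\subset G=\mathbb{Z}/N\mathbb{Z}$ be a fixed set with $|S|=s$, let $C>0$, and let $\Omega$ be a random subset of $\mathbb{Z}/N\mathbb{Z}$ obtained by random selection of parameter $\tau\in(0,1)$, where $$E(|\Omega|)=\tau N=(3s+2)\,C\log N .$$ Let $\mu,\nu\ge 4$ be integers, put $a=\cos\frac{\pi}{\nu}$, and let $\alpha'>0$ be a real number satisfying $$Ca^2\Big(1-2\sin\frac{\pi}{2\mu}\Big)\Big(1-2\sin\frac{\pi}{2\mu}-2\alpha'\Big)=1 .$$ Then the probability of the event (ii) for every $z:G\to\mathbb{C}$, $z\neq 0$, with $\hat z|_\Omega=0$, one has $\sum_{t\in G\setminus S}|z(t)|>\sum_{t\in S}|z(t)|$ satisfies $$P(\text{(ii)})\ \ge\ 1-\nu\,\mu^s\,(s+1)\,N^{-Ca^2\alpha'^2}.$$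
   Context: For $z:G\to\mathbb{C}$, $\hat z(\omega)=\frac1{\sqrt N}\sum_{t\in G}z(t)\exp(-2\pi i t\omega/N)$ for $\omega\in\mathbb{Z}/N\mathbb{Z}$. ''Random selection of parameter $\tau$ on $\mathbb{Z}/N\mathbb{Z}$'' means that the events $(n\in\Omega)$, $n\in\mathbb{Z}/N\mathbb{Z}$, are independent and each has probability $\tau$. $\log$ is the natural logarithm. *)

(* Defs.v *)
From HB Require Import structures.
From mathcomp Require Import all_boot all_order all_algebra.
From mathcomp Require Import all_classical all_reals all_analysis.
From mathcomp Require Import complex.

Set Implicit Arguments.
Unset Strict Implicit.
Unset Printing Implicit Defensive.

Import Order.TTheory GRing.Theory Num.Theory.

Local Open Scope classical_set_scope.
Local Open Scope complex_scope.
Local Open Scope ring_scope.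

Section Fourier.
Variables (R : realType) (N : nat).

Definition expi (x : R) : R[i] := cos x +i* sin x.

(* The group Z/N is represented by its residues 'I_N: the character
   exp(- 2 i pi t w / N) only depends on the classes of t and w modulo N, and
   the type 'Z_N would be wrong for N = 1. *)
Definition fourier (z : {ffun 'I_N -> R[i]}) (w : 'I_N) : R[i] :=
  ((Num.sqrt (N%:R : R))^-1)%:C *
  \sum_(t : 'I_N) z t * expi (- (2 * pi * t%:R * w%:R / N%:R)).

(* The two sums are compared for the order of R[i], which is the usual order
   on elements with the same imaginary part; moduli have imaginary part 0. *)
Definition l1_dominated_off (S Omega : {set 'I_N}) : Prop :=
  forall z : {ffun 'I_N -> R[i]}, z != 0 ->
    (forall w, w \in Omega -> fourier z w = 0) ->
    \sum_(t in ~: S) `|z t| > \sum_(t in S) `|z t|.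

End Fourier.

Section RandomSelection.
Context {d : measure_display} {T : measurableType d} {R : realType}.
Variables (P : probability T R) (I : finType).

Definition independent_events (E : I -> set T) : Prop :=
  forall B : {set I},
    P (\bigcap_(i in [set` B]) E i) = (\prod_(i in B) P (E i))%E.

Definition random_selection (tau : R) (Omega : T -> {set I}) : Prop :=
  let E i := [set w : T | i \in Omega w] in
  [/\ forall i, measurable (E i),
      independent_events E &
      forall i, P (E i) = tau%:E].

End RandomSelection.

(* Main.v *)
(** Put p(t) = (1 / tau N) sum_(w in Omega) sum_(s in S) u(s) e(w (s - t) / N).
    Its spectrum lies in Omega, so it is orthogonal to every z whose transform
    vanishes on Omega, and by orthogonality of characters its mean is u on S
    and 0 off S. If p stays within alpha of u on S and below b - alpha off S,
    where b = 1 - 2 sin (pi / 2 mu) and u takes the mu-th roots of unity closest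
    to the conjugate phases of z, then pairing z with p gives (ii).
    A Chernoff bound for the real part of p in each of nu directions shows that
    the deviation of p at one point exceeds x <= 1 with probability at most
    nu N^(- C a^2 x^2). In the union bound over the mu^s patterns u and the N
    points, the s points of S use x = alpha and the others x = b - alpha; the
    relation on C says that N N^(- C a^2 (b - alpha)^2) = N^(- C a^2 alpha^2),
    hence the factor s + 1. *)

Require Import Defs.
From HB Require Import structures.
From mathcomp Require Import all_boot all_order all_algebra.
From mathcomp Require Import all_classical all_reals all_analysis.
From mathcomp Require Import complex ring lra.

Set Implicit Arguments.
Unset Strict Implicit.
Unset Printing Implicit Defensive.

Import Order.TTheory GRing.Theory Num.Theory.
Import numFieldNormedType.Exports.

Local Open Scope classical_set_scope.
Local Open Scope ring_scope.

(** * Chernoff bound for sums over a random subset *)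

(* The function (1 + x + 3/4 x^2) exp(-x) has derivative
   x (2 - 3 x) exp(-x) / 4, so on ]-oo, 2/3] it is minimal at 0. *)
Lemma expR_le_quadratic (R : realType) (x : R) : x <= 2 / 3 ->
  expR x <= 1 + x + 3 / 4 * x ^+ 2.
Proof.
move=> hx.
pose h := fun y : R => (1 + y + 3 / 4 * y ^+ 2) * expR (- y).
pose dh := fun y : R => y * (2 - 3 * y) / 4 * expR (- y).
have dhP (y : R) : is_derive y 1 h (dh y).

  apply: is_derive_eq; rewrite /dh /GRing.scale /=; by field.
have ch : continuous h.
  move=> u; apply/differentiable_continuous/derivable1_diffP.
  exact: (@ex_derive _ _ _ _ _ _ _ (dhP u)).
have h0 : h 0 = 1 by rewrite /h oppr0 expR0; ring.
suff : 1 <= h x.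
  by rewrite /h expRN -ler_pdivrMr ?invr_gt0 ?expR_gt0// div1r invrK.
rewrite -h0 -subr_ge0; have [x0|/ltW x0] := leP 0 x.
  have [c + ->] := MVT_segment x0 (fun y _ => dhP y) (continuous_subspaceT ch).
  rewrite in_itv /= => /andP[c0 cx]; rewrite subr0 mulr_ge0 // /dh.
  by rewrite mulr_ge0 ?expR_ge0 // divr_ge0 // mulr_ge0 // subr_ge0; lra.
have [c + E] := MVT_segment x0 (fun y _ => dhP y) (continuous_subspaceT ch).
rewrite in_itv /= => /andP[cx c0].
rewrite -opprB E sub0r mulrN opprK /dh.
have -> : c * (2 - 3 * c) / 4 * expR (- c) * x
        = (- c * - x) * (2 - 3 * c) / 4 * expR (- c) by ring.
rewrite mulr_ge0 ?expR_ge0 // divr_ge0 // mulr_ge0 //; last by lra.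
by apply: mulr_ge0; lra.
Qed.

Section FiniteSelection.
Variables (R : realType) (I : finType) (tau : R) (q : {set I} -> R).
Hypothesis q_ge0 : forall A, 0 <= q A.
Hypothesis q_superset :
  forall B : {set I}, \sum_(A : {set I} | B \subset A) q A = tau ^+ #|B|.

(* Expanding the product over A turns the mean into a combination of the
   probabilities of the events that Omega contains B. *)
Lemma selection_mean_prod (y : I -> R) :
  \sum_(A : {set I}) q A * \prod_(i in A) (1 + y i) = \prod_i (1 + tau * y i).
Proof.
have expand (z : I -> R) :
    \prod_i (1 + z i) = \sum_(B : {set I}) \prod_(i in B) z i.
  rewrite (eq_bigr (fun i => z i + 1)) => [|i _]; last exact: addrC.
  rewrite bigA_distr; apply: eq_big => [B|B _]; first by rewrite ?inE.
  by rewrite [RHS]big_mkcond.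
under [LHS]eq_bigr => A _.
  (* With [y] set to 0 off [A] the product runs over all indices, and the subsets [B] not contained
     in [A] contribute 0. *)
  rewrite big_mkcond (eq_bigr (fun i => 1 + (if i \in A then y i else 0)));
    last by move=> i _; case: ifP; rewrite ?addr0.
  rewrite expand mulr_sumr.
  rewrite (eq_bigr (fun B : {set I} =>
    if B \subset A then q A * \prod_(i in B) y i else 0)); last first.
    move=> B _; case: ifPn => [/fintype.subsetP sBA|/subsetPn[i iB iA]].
      by congr (_ * _); apply: eq_bigr => i /sBA ->.
    by rewrite (bigD1 i) //= (negbTE iA) mul0r mulr0.
  over.
rewrite exchange_big /= expand; apply: eq_bigr => B _.
rewrite -big_mkcond -mulr_suml q_superset big_split /= prodr_const.
by [].
Qed.

(** Exponential moment method. The parameter [la], 2x / (3 tau V), minimises - la x + (3/4) la^2 tau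
    V; the hypothesis on [x * M] keeps each [la * c i] at most 2/3, the range of the quadratic bound
    for [expR]. *)
Lemma selection_chernoff (c : I -> R) (M V x : R) :
    0 < tau -> tau <= 1 -> 0 < V -> 0 <= x -> (forall i, c i <= M) ->
    \sum_i c i ^+ 2 <= V -> x * M <= tau * V ->
  \sum_(A : {set I} | tau * \sum_i c i + x <= \sum_(i in A) c i) q A
    <= expR (- (x ^+ 2 / (3 * (tau * V)))).
Proof.
move=> t0 t1 V0 x0 cM cV xM.
pose tV := tau * V; have tV0 : 0 < tV by rewrite mulr_gt0.
pose la := 2 * x / (3 * tV).
have la0 : 0 <= la by rewrite /la divr_ge0 ?mulr_ge0 // ltW.
have lac i : la * c i <= 2 / 3.
  apply: (@le_trans _ _ (la * M)); first by rewrite ler_wpM2l.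
  rewrite /la mulrAC ler_pdivrMr ?mulr_gt0 //.
  have -> : 2 / 3 * (3 * tV) = 2 * tV by field.
  by rewrite -mulrA ler_wpM2l.
pose m := tau * \sum_i c i + x.
have step : \sum_(A : {set I} | m <= \sum_(i in A) c i) q A <=
    expR (- (la * m)) *
      \sum_(A : {set I}) q A * \prod_(i in A) (1 + (expR (la * c i) - 1)).
  rewrite mulr_sumr big_mkcond; apply: ler_sum => A _.
  under [X in _ <= _ * (_ * X)]eq_bigr do rewrite addrC subrK.
  rewrite -expR_sum -mulr_sumr mulrCA -expRD.
  case: ifP => hA; last by rewrite mulr_ge0 ?expR_ge0.
  rewrite ler_peMr // -expR0 ler_expR addrC -mulrN -mulrDr mulr_ge0 //.
  by rewrite subr_ge0.
apply: (le_trans step); rewrite selection_mean_prod.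
(* Each factor satisfies 1 + tau v <= exp(tau v), and v = exp(la c_i) - 1 is then replaced by its
   quadratic bound. *)
apply: (@le_trans _ _ (expR (- (la * m)) *
   \prod_i expR (tau * (la * c i + 3 / 4 * (la * c i) ^+ 2)))).
  rewrite ler_wpM2l ?expR_ge0 //; apply: ler_prod => i _; apply/andP; split.
    rewrite mulrBr mulr1 addrCA addr_ge0 ?mulr_ge0 ?expR_ge0 ?subr_ge0 //.
    exact: ltW.
  apply: le_trans (expR_ge1Dx _) _; rewrite ler_expR ler_wpM2l ?(ltW t0) //.
  by rewrite lerBlDl addrA expR_le_quadratic.
rewrite -expR_sum -expRD ler_expR.
under eq_bigr do rewrite mulrDr exprMn.
rewrite big_split /= -!mulr_sumr.
rewrite {step}/m; set X := \sum_i c i; set Y := \sum_i c i ^+ 2 in cV *.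
have -> : x ^+ 2 / (3 * tV) = la * x - 3 / 4 * la ^+ 2 * tV.
  by rewrite /la; field; rewrite gt_eqF.
suff : 3 / 4 * la ^+ 2 * (tau * Y) <= 3 / 4 * la ^+ 2 * tV by lra.
apply: ler_wpM2l; first by rewrite mulr_ge0 ?sqr_ge0.
by apply: ler_wpM2l; first exact: ltW.
Qed.

(** Union bound, used for the [nu] directions and again for the pairs of a pattern and a point. *)
Lemma sum_le_cover (J : finType) (K : pred J) (Q : J -> pred {set I})
    (E : pred {set I}) :
    (forall A, E A -> exists2 j, K j & Q j A) ->
  \sum_(A | E A) q A <= \sum_(j | K j) \sum_(A | Q j A) q A.
Proof.
move=> cover.
under [X in _ <= X]eq_bigr do rewrite big_mkcond.
rewrite exchange_big big_mkcond; apply: ler_sum => A _.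
have ge0 j : 0 <= (if Q j A then q A else 0) by case: ifP.
case: ifP => [/cover[j Kj QjA]|_]; last by apply: sumr_ge0.
by rewrite (bigD1 j) //= QjA lerDl sumr_ge0.
Qed.

End FiniteSelection.

(** * The law of the random set as weights on subsets *)

(** [Omega] takes finitely many values, so any event about it is a finite disjoint union of
    measurable atoms. Independence gives the probability that [Omega] contains [B]. *)
Lemma selection_law d (T : measurableType d) (R : realType)
    (P : probability T R) (I : finType) (tau : R) (Omega : T -> {set I}) :
    random_selection P tau Omega ->
  exists q : {set I} -> R, [/\ forall A, 0 <= q A,
    forall B : {set I}, \sum_(A : {set I} | B \subset A) q A = tau ^+ #|B| &
    forall Q : pred {set I},
      P [set w | Q (Omega w)] = (\sum_(A : {set I} | Q A) q A)%:E].
Proof.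
case=> mE indep PE.
have mA (A : {set I}) : measurable [set w | Omega w = A].
  have -> : [set w | Omega w = A] = \bigcap_(i in [set: I])
      (if i \in A then [set w | i \in Omega w]
       else ~` [set w | i \in Omega w]).
    apply/seteqP; split => [w <- i _|w h].
      by case: ifPn => //= /negP.
    apply/setP => i; have := h i Logic.I; case: ifPn => //= ?.
    by move/negP/negbTE.
  apply: fin_bigcap_measurable => // i _; case: ifP => // _.
  by apply: measurableC.
have PQ (Q : pred {set I}) : P [set w | Q (Omega w)] =
    (\sum_(A : {set I} | Q A) fine (P [set w | Omega w = A]))%:E.
  have -> : [set w | Q (Omega w)] =
      \bigcup_(A in [set A | Q A]) [set w | Omega w = A].
    by apply/seteqP; split => [w ? /=|w [A ? /= ->] //]; exists (Omega w).
  rewrite measure_fin_bigcup //; first last.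
    by move=> A B _ _ [w [/= <- <-]].
    exact: finite_finset.
  rewrite -(bigfs _ (index_enum_uniq _)) => [|A _]; last first.
    by rewrite mem_index_enum.
  rewrite -sumEFin; apply: eq_bigr => A _.
  by rewrite fineK // fin_num_measure.
exists (fun A : {set I} => fine (P [set w | Omega w = A])); split => //.
  by move=> A; exact: fine_ge0.
  move=> B; apply: EFin_inj.
  rewrite -PQ -prodr_const -prodEFin -(eq_bigr _ (fun i _ => PE i)).
  rewrite -indep; congr (P _); apply/seteqP; split => w /=.
    by move/fintype.subsetP => h i /= /h.
  by move=> h; apply/fintype.subsetP => i iB; exact: h.
Qed.

(** * Complex exponentials and roots of unity *)

Section ComplexExponential.
Variable R : realType.
Local Open Scope complex_scope.
Local Notation normc := (@ComplexField.Normc.normc R).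

Lemma ReD (z w : R[i]) : complex.Re (z + w) = complex.Re z + complex.Re w.
Proof. by case: z; case: w. Qed.

Lemma Re_sum I (r : seq I) (Q : pred I) (F : I -> R[i]) :
  complex.Re (\sum_(i <- r | Q i) F i) = \sum_(i <- r | Q i) complex.Re (F i).
Proof. by apply: big_morph => // z w; exact: ReD. Qed.

Lemma ReZ (x : R) (z : R[i]) : complex.Re (x%:C * z) = x * complex.Re z.
Proof. by case: z => u v /=; rewrite mul0r subr0. Qed.

Lemma normr_normc (z : R[i]) : `|z| = (normc z)%:C.
Proof. by []. Qed.

Lemma normc_ge0 (z : R[i]) : 0 <= normc z.
Proof. by case: z => x y; exact: sqrtr_ge0. Qed.

Lemma normr_Re_le (z : R[i]) : `|complex.Re z| <= normc z.
Proof. by rewrite -lecR -normr_normc normc_ge_Re. Qed.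

Lemma normc_sum_le I (r : seq I) (Q : pred I) (F : I -> R[i]) :
  normc (\sum_(i <- r | Q i) F i) <= \sum_(i <- r | Q i) normc (F i).
Proof. by rewrite -lecR rmorph_sum -normr_normc; exact: ler_norm_sum. Qed.

Lemma expiD (x y : R) : expi (x + y) = expi x * expi y.
Proof. by rewrite /expi cosD sinD; congr (_ +i* _); ring. Qed.

Lemma expi0 : expi (0 : R) = 1.
Proof. by rewrite /expi cos0 sin0. Qed.

Lemma expiX (x : R) n : expi (x *+ n) = expi x ^+ n.
Proof.
by elim: n => [|n IHn]; rewrite ?expi0 // mulrS expiD IHn exprS.
Qed.

Lemma expiN (x : R) : expi (- x) = (expi x)^-1.
Proof.
have e : expi x * expi (- x) = 1 by rewrite -expiD subrr expi0.
have e0 : expi x != 0.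
  by apply: contra_eq_neq e => ->; rewrite mul0r eq_sym oner_neq0.
by apply: (mulfI e0); rewrite e mulfV.
Qed.

Lemma normc_expi (x : R) : normc (expi x) = 1.
Proof. by rewrite /= cos2Dsin2 sqrtr1. Qed.

(** A power with exponent strictly between 0 and [n] differs from 1 already in its real part 1 - 2
    sin^2 y, where 0 < y < pi. *)
Lemma expi_prim_root n : (0 < n)%N ->
  n.-primitive_root (expi (2 * pi / n%:R : R)).
Proof.
move=> n0; apply/andP; split => //; apply/forallP => i.
have nR : 0 < n%:R :> R by rewrite ltr0n.
apply/eqP; rewrite unity_rootE -expiX; case: (eqVneq i.+1 n) => [->|ni].
  have -> : (2 * pi / n%:R : R) *+ n = pi *+ 2.
    by rewrite -[LHS]mulr_natr -[RHS]mulr_natr; field; rewrite gt_eqF.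
  by rewrite /expi cos2pi sin2pi eqxx.
apply/negbTE; rewrite eq_complex negb_and; apply/orP; left => /=.
set y : R := pi * i.+1%:R / n%:R.
have -> : (2 * pi / n%:R) *+ i.+1 = y *+ 2.
  by rewrite /y -[LHS]mulr_natr -[RHS]mulr_natr; field; rewrite gt_eqF.
rewrite cos_mulr2n cos2sin2 mulrnBl -addrA -[X in X + _]addr0.
have : 0 < sin y.
  apply: sin_gt0_pi; rewrite /y divr_gt0 ?mulr_gt0 ?pi_gt0 ?ltr0n //=.
  rewrite ltr_pdivrMr // ltr_pM2l ?pi_gt0 // ltr_nat.
  by rewrite ltn_neqAle ni ltn_ord.
move=> s0; rewrite lt_eqF //.
have : 0 < sin y ^+ 2 by rewrite exprn_gt0.
by lra.
Qed.

(* Among the rotates of z by n-th roots of unity take one of maximal real part: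
   comparing it with its two neighbours bounds its argument by pi / n. *)
Lemma root_of_unity_direction n (z : R[i]) : (1 < n)%N ->
  exists k : 'I_n,
    cos (pi / n%:R) * normc z <= complex.Re (expi (2 * pi / n%:R : R) ^+ k * z).
Proof.
move=> n1; have n0 : (0 < n)%N by exact: ltn_trans n1.
have nR : 0 < n%:R :> R by rewrite ltr0n.
set th : R := pi / n%:R; set om := expi _.
have prim : n.-primitive_root om by exact: expi_prim_root.
pose f (k : 'I_n) := complex.Re (om ^+ k * z).
have [k _ kmax] := @arg_maxP _ _ 'I_n (Ordinal n0) xpredT f isT.
exists k; rewrite -/(f k).
have nv : normc z = normc (om ^+ k * z).
  rewrite ComplexField.Normc.normcM; have := normc_expi ((2 * pi / n%:R) *+ k).
  by rewrite expiX -/om => ->; rewrite mul1r.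
have shift j : complex.Re (om ^+ j * (om ^+ k * z)) <= f k.
  rewrite mulrA -exprD -(prim_expr_mod prim).
  exact: (kmax (Ordinal (ltn_pmod (j + k) n0))).
have := shift 1%N; have := shift n.-1.
have omE : om = (1 - 2 * sin th ^+ 2) +i* (2 * (sin th * cos th)).
  rewrite /om; have -> : 2 * pi / n%:R = th *+ 2.
    by rewrite /th -mulr_natr; ring.
  by rewrite /expi cos_mulr2n sin_mulr2n cos2sin2; congr (_ +i* _); ring.
have -> : om ^+ n.-1 = (1 - 2 * sin th ^+ 2) -i* (2 * (sin th * cos th)).
  have om0 : om != 0 by rewrite (prim_root_eq0 prim) -lt0n.
  have -> : om ^+ n.-1 = om^-1.
    by apply: (mulfI om0); rewrite -exprS prednK // prim_expr_order ?mulfV.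
  have -> : 2 * (sin th * cos th) = sin (th *+ 2) by rewrite sin_mulr2n; ring.
  have -> : 1 - 2 * sin th ^+ 2 = cos (th *+ 2).
    by rewrite cos_mulr2n cos2sin2; ring.
  rewrite -[X in X -i* _]cosN -sinN -[LHS]expiN /om.
  by congr expi; rewrite /th -mulr_natr; ring.
rewrite expr1 nv /f; move: (om ^+ k * z) => v; rewrite omE.
case: v => x y /= h1 h2.
have s0 : 0 < sin th.
  apply: sin_gt0_pi; rewrite /th divr_gt0 ?pi_gt0 //=.
  by rewrite ltr_pdivrMr // ltr_pMr ?pi_gt0 // ltr1n.
have c0 : 0 <= cos th.
  apply: cos_ge0_pihalf; rewrite /th; apply/andP; split.
    by apply: (@le_trans _ _ 0); rewrite ?oppr_le0 divr_ge0 ?pi_ge0.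
  by rewrite ler_pM2l ?pi_gt0 // lef_pV2 ?posrE ?ltr0n // ler_nat.
have cs : cos th ^+ 2 = 1 - sin th ^+ 2 by exact: cos2sin2.
move: (sin th) (cos th) s0 c0 cs h1 h2 => s c s0 c0 cs h1 h2.
(* The two neighbours give |y| cos th <= x sin th; squaring and adding x^2 cos^2 th yields (x^2 +
   y^2) cos^2 th <= x^2. *)
have {}h1 : y * c <= x * s by rewrite -(ler_pM2l s0); nra.
have {}h2 : - (y * c) <= x * s by rewrite -(ler_pM2l s0); nra.
have x0 : 0 <= x by rewrite -(pmulr_lge0 _ s0); lra.
have h3 : (y * c) ^+ 2 <= (x * s) ^+ 2.
  by rewrite -subr_ge0 subr_sqr mulr_ge0 //; lra.
rewrite -[X in _ <= X]ger0_norm // -sqrtr_sqr.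
rewrite -{1}(ger0_norm c0) -(sqrtr_sqr c) -sqrtrM ?sqr_ge0 //.
by rewrite ler_wsqrtr //; nra.
Qed.

(** Orthogonality of characters: a geometric sum whose ratio is an [N]-th root of unity, equal to 1
    only for [s = t]. *)
Lemma sum_characters N (s t : 'I_N) :
  let zeta := expi (2 * pi / N%:R : R) in
  \sum_(w < N) zeta ^+ (s * w) / zeta ^+ (t * w) = (N * (s == t))%:R.
Proof.
move=> zeta; have N0 : (0 < N)%N by case: N s {t zeta} => // -[].
have prim : N.-primitive_root zeta by exact: expi_prim_root.
have z0 j : zeta ^+ j != 0.
  by rewrite expf_neq0 // (prim_root_eq0 prim) -lt0n.
set x := zeta ^+ s / zeta ^+ t.
have -> : \sum_(w < N) zeta ^+ (s * w) / zeta ^+ (t * w) = \sum_(w < N) x ^+ w.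
  by apply: eq_bigr => w _; rewrite /x !exprM exprMn exprVn.
case: (eqVneq s t) => [st|st].
  rewrite /x st mulfV // muln1 (eq_bigr (fun => 1)); last first.
    by move=> w _; rewrite expr1n.
  by rewrite sumr_const card_ord.
have x1 : x != 1.
  rewrite /x -(inj_eq (mulIf (z0 t))) mulfVK // mul1r (eq_prim_root_expr prim).
  by rewrite !modn_small.
have xN : x ^+ N = 1.
  by rewrite /x exprMn exprVn -!exprM ![(_ * N)%N]mulnC !exprM
    (prim_expr_order prim) !expr1n invr1 mulr1.
have : (x - 1) * \sum_(w < N) x ^+ w = 0 by rewrite -subrX1 xN subrr.
by move/eqP; rewrite mulf_eq0 subr_eq0 (negbTE x1) muln0 => /eqP.
Qed.

End ComplexExponential.

(** * Trigonometric polynomials with spectrum in the random set *)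

Section SamplingPolynomials.
Variables (R : realType) (N : nat).
Local Open Scope complex_scope.
Local Notation normc := (@ComplexField.Normc.normc R).
Implicit Types (S A : {set 'I_N}) (u : 'I_N -> R[i]) (s t w : 'I_N).

Let zeta : R[i] := expi (2 * pi / N%:R).

Let zeta_neq0 k : zeta ^+ k != 0.
Proof.
rewrite expf_neq0 //; apply/eqP => z0.
have := normc_expi (2 * pi / N%:R : R).
by rewrite -/zeta z0 ComplexField.Normc.normc0; lra.
Qed.

Let normc_zeta k : normc (zeta ^+ k) = 1.
Proof. by rewrite -expiX normc_expi. Qed.

Definition sampling_coef S u w : R[i] := \sum_(s in S) u s * zeta ^+ (s * w).

(* Up to the normalisation by tau N, the trigonometric polynomial with
   spectrum in the random set A whose mean is u on S and 0 off S. *)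
Definition sampling_poly S A u t : R[i] :=
  \sum_(w in A) sampling_coef S u w / zeta ^+ (t * w).

Definition restrict_to S u t : R[i] := if t \in S then u t else 0.

(** Fourier inversion. Multiplied by [tau] this is the mean of the random polynomial, each frequency
    being kept with probability [tau]. *)
Lemma sampling_poly_full S u t :
  \sum_w sampling_coef S u w / zeta ^+ (t * w) = N%:R * restrict_to S u t.
Proof.
under eq_bigr do rewrite mulr_suml.
rewrite exchange_big /=.
rewrite (eq_bigr (fun s => u s * (N * (s == t))%:R)); last first.
  move=> s _; rewrite -sum_characters mulr_sumr.
  by apply: eq_bigr => w _; rewrite mulrA.
rewrite big_mkcond (bigD1 t) //= eqxx muln1 big1 => [|s /negbTE ->]; last first.
  by rewrite muln0 mulr0 if_same.
by rewrite addr0 /restrict_to; case: ifP => _; rewrite ?mulr0 // mulrC.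
Qed.

(** Parseval, by expanding one conjugate factor and inverting at the points of [S]. It supplies the
    parameter [V] of the Chernoff bound. *)
Lemma sum_sqr_sampling_coef S u : (forall s, normc (u s) = 1) ->
  \sum_w normc (sampling_coef S u w) ^+ 2 = N%:R * #|S|%:R.
Proof.
move=> u1; apply: (@complexI R); rewrite rmorph_sum /=.
have sq (z : R[i]) : (normc z ^+ 2)%:C = z * z^*.
  by rewrite rmorphXn /= -normr_normc sqr_normc.
have cz k : (zeta ^+ k)^* = (zeta ^+ k)^-1.
  apply: (mulfI (zeta_neq0 k)); rewrite -sq normc_zeta expr1n mulfV //.
rewrite (eq_bigr (fun w => \sum_(t in S)
    (u t)^* * (sampling_coef S u w / zeta ^+ (t * w)))); last first.
  move=> w _; rewrite sq {2}/sampling_coef.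
  rewrite rmorph_sum mulr_sumr; apply: eq_bigr => t _.
  by rewrite [X in _ * X]rmorphM [X in _ * (_ * X)]cz mulrCA.
rewrite exchange_big /= (eq_bigr (fun=> N%:R)); last first.
  move=> t tS; rewrite -mulr_sumr sampling_poly_full /restrict_to tS.
  by rewrite mulrCA [_^* * _]mulrC -sq u1 expr1n mulr1.
by rewrite sumr_const rmorphM /= !rmorph_nat mulr_natr.
Qed.

Lemma normc_sampling_coef_le S u w : (forall s, normc (u s) = 1) ->
  normc (sampling_coef S u w) <= #|S|%:R.
Proof.
move=> u1; apply: le_trans (normc_sum_le _ _ _) _.
rewrite (eq_bigr (fun=> 1)) ?sumr_const // => s _.
by rewrite ComplexField.Normc.normcM u1 normc_zeta mulr1.
Qed.

(** Exchanging the sums leaves a combination of the values of [fourier z] on [A]. *)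
Lemma sum_mul_sampling_poly S A u (z : {ffun 'I_N -> R[i]}) :
  (0 < N)%N -> (forall w, w \in A -> fourier z w = 0) ->
  \sum_t z t * sampling_poly S A u t = 0.
Proof.
move=> N0 hz; under eq_bigr do rewrite mulr_sumr.
rewrite exchange_big /= big1 // => w /hz /eqP.
rewrite mulf_eq0 => /orP[/eqP/complexI/eqP|/eqP e].
  by rewrite invr_eq0 sqrtr_eq0 lern0 -leqn0 leqNgt N0.
rewrite (eq_bigr (fun t => sampling_coef S u w *
    (z t * expi (- (2 * pi * t%:R * w%:R / N%:R))))); last first.
  move=> t _; rewrite mulrCA; congr (_ * (_ * _)).
  rewrite expiN /zeta -expiX; congr (_^-1); congr expi.
  by rewrite -[LHS]mulr_natr natrM; ring.
by rewrite -mulr_sumr e mulr0.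
Qed.

(** * Tail bounds for the deviation at one point *)

Section Tail.
Variables (tau : R) (q : {set 'I_N} -> R).
Hypothesis q_ge0 : forall A, 0 <= q A.
Hypothesis q_superset :
  forall B : {set 'I_N}, \sum_(A : {set 'I_N} | B \subset A) q A = tau ^+ #|B|.
Hypotheses (tau_gt0 : 0 < tau) (tau_le1 : tau <= 1) (N_gt0 : (0 < N)%N).

Let dev S u A t : R[i] :=
  sampling_poly S A u t - (tau * N%:R)%:C * restrict_to S u t.

(** Chernoff with [M] = |S|, [V] = N |S| and deviation tau N y; the condition [x * M <= tau * V]
    then reads [y <= 1]. *)
Lemma sampling_poly_tail_Re S u t (om : R[i]) (y : R) :
    (0 < #|S|)%N -> (forall s, normc (u s) = 1) -> normc om = 1 ->
    0 <= y <= 1 ->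
  \sum_(A | tau * N%:R * y <= complex.Re (om * dev S u A t)) q A
    <= expR (- (tau * N%:R * y ^+ 2 / (3 * #|S|%:R))).
Proof.
move=> S0 u1 om1 /andP[y0 y1].
have NR : 0 < N%:R :> R by rewrite ltr0n.
have SR : 0 < #|S|%:R :> R by rewrite ltr0n.
pose c w := complex.Re (om * (sampling_coef S u w / zeta ^+ (t * w))).
have c_norm w : `|c w| <= normc (sampling_coef S u w).
  apply: le_trans (normr_Re_le _) _; rewrite !ComplexField.Normc.normcM om1.
  by rewrite ComplexField.Normc.normcV normc_zeta invr1 mul1r mulr1.
have := @selection_chernoff R 'I_N tau q q_ge0 q_superset c #|S|%:R
  (N%:R * #|S|%:R) (tau * N%:R * y) tau_gt0 tau_le1.
have -> : (tau * N%:R * y) ^+ 2 / (3 * (tau * (N%:R * #|S|%:R)))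
    = tau * N%:R * y ^+ 2 / (3 * #|S|%:R).
  by field; rewrite !gt_eqF.
move=> chern; apply: le_trans (chern _ _ _ _ _).
- rewrite le_eqVlt; apply/orP; left; apply/eqP; apply: eq_bigl => A.
  have -> : complex.Re (om * dev S u A t) =
      \sum_(w in A) c w - tau * \sum_w c w.
    rewrite -!Re_sum -!mulr_sumr sampling_poly_full -mulNr -ReZ -ReD /dev.
    congr complex.Re; rewrite rmorphN rmorphM /= rmorph_nat.
    by rewrite -/(sampling_poly S A u t); ring.
  by rewrite lerBrDl.
- by rewrite mulr_gt0.
- by rewrite !mulr_ge0 // ltW.
- move=> w; apply: le_trans (ler_norm _) _; apply: le_trans (c_norm w) _.
  exact: normc_sampling_coef_le.
- rewrite -(sum_sqr_sampling_coef S u1); apply: ler_sum => w _.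
  by rewrite -real_normK ?num_real // lerXn2r ?nnegrE ?normc_ge0.
- rewrite -!mulrA ler_pM2l // ler_pM2l // -[leRHS]mul1r ler_wpM2r //.
Qed.

(** A complex number has a rotate by some [nu]-th root of unity whose real part is at least cos(pi /
    nu) times its modulus, so the real tail bound is summed over [nu] directions. *)
Lemma sampling_poly_tail S u t (nu : nat) (x : R) :
    (0 < #|S|)%N -> (forall s, normc (u s) = 1) -> (1 < nu)%N ->
    0 <= x <= 1 ->
  \sum_(A | tau * N%:R * x <= normc (dev S u A t)) q A
    <= nu%:R * expR (- (tau * N%:R * (cos (pi / nu%:R) * x) ^+ 2
                        / (3 * #|S|%:R))).
Proof.
move=> S0 u1 nu1 /andP[x0 x1]; set a := cos _.
have a0 : 0 <= a.
  apply: cos_ge0_pihalf; apply/andP; split.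
    by apply: (@le_trans _ _ 0); rewrite ?oppr_le0 divr_ge0 ?pi_ge0.
  rewrite ler_pM2l ?pi_gt0 // lef_pV2 ?posrE ?ltr0n ?ler_nat //.
  exact: ltn_trans nu1.
pose om (k : 'I_nu) : R[i] := expi (2 * pi / nu%:R) ^+ k.
apply: le_trans (@sum_le_cover _ _ _ q_ge0 _ xpredT
  (fun k A => tau * N%:R * (a * x) <= complex.Re (om k * dev S u A t)) _ _) _.
  move=> A hA; have [k hk] := root_of_unity_direction (dev S u A t) nu1.
  exists k => //; apply: le_trans hk; rewrite mulrCA.
  exact: ler_wpM2l.
have ax1 : 0 <= a * x <= 1.
  by rewrite mulr_ge0 //= mulr_ile1 //; exact: cos_le1.
have om1 k : normc (om k) = 1 by rewrite /om -expiX normc_expi.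
apply: le_trans (ler_sum _ (fun k _ =>
  sampling_poly_tail_Re t S0 u1 (om1 k) ax1)) _.
by rewrite sumr_const card_ord [leRHS]mulr_natl.
Qed.

End Tail.

(** * From approximate interpolation to domination off [S] *)

(** Phases are discretised to [mu]-th roots of unity so that a union bound over patterns is
    possible. *)
Definition root_pattern mu (f : {ffun 'I_N -> 'I_mu}) s : R[i] :=
  expi (2 * pi / mu%:R) ^+ f s.

(** The pairing of [z] with [p] vanishes. Its real part is at least K (b - alpha) |z(t)| on [S] and
    at least - K (b - alpha) |z(t)| off [S], strictly where [z] is nonzero. *)
Lemma l1_dominated_off_of_interpolation S A mu (k0 : 'I_mu) (K b alpha : R) :
    (0 < N)%N -> (1 < mu)%N -> 0 < K -> b <= cos (pi / mu%:R) -> alpha < b ->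
    (forall f t, f \in pffun_on k0 (mem S) predT ->
      normc (sampling_poly S A (root_pattern f) t
             - K%:C * restrict_to S (root_pattern f) t)
        < K * (if t \in S then alpha else b - alpha)) ->
  l1_dominated_off R S A.
Proof.
move=> N0 mu1 K0 bmu ab approx z z0 hz.
have /choice[k kP] : forall t, exists k : 'I_mu,
    cos (pi / mu%:R) * normc (z t)
      <= complex.Re (expi (2 * pi / mu%:R) ^+ k * z t).
  by move=> t; exact: root_of_unity_direction.
(* The default [k0] off [S] does not affect [p] and leaves only mu^|S| patterns to consider. *)
pose f : {ffun 'I_N -> 'I_mu} := [ffun t => if t \in S then k t else k0].
have fS : f \in pffun_on k0 (mem S) predT.
  apply/pffun_onP; split => //; apply/fintype.subsetP => t.
  by rewrite inE ffunE; case: ifP => //; rewrite eqxx.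
have {}approx t := approx f t fS.
have dual := sum_mul_sampling_poly S (root_pattern f) N0 hz.
set p := sampling_poly S A (root_pattern f) in approx dual.
(* The pointwise slack: its sum is K (b - alpha) times the difference of the two sums to be
   compared. *)
pose g t := complex.Re (z t * p t)
  - (if t \in S then 1 else -1) * (K * (b - alpha) * normc (z t)).
have Re_ge (x y : R[i]) : - (normc x * normc y) <= complex.Re (x * y).
  rewrite -ComplexField.Normc.normcM.
  by have := normr_Re_le (x * y); rewrite ler_norml => /andP[].
have g_ge t : normc (z t) * (K * (if t \in S then alpha else b - alpha)
     - normc (p t - K%:C * restrict_to S (root_pattern f) t)) <= g t.
  rewrite /g.
  have := Re_ge (z t) (p t - K%:C * restrict_to S (root_pattern f) t).
  rewrite mulrBr ReD /restrict_to; case: ifP => tS; last first.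
    rewrite !mulr0 !subr0; set X := normc (p t); lra.
  have := kP t; rewrite /root_pattern ffunE tS.
  set e := expi _ ^+ _ => he.
  have -> : - (z t * (K%:C * e)) = (- K)%:C * (e * z t).
    by rewrite rmorphN /=; ring.
  rewrite ReZ; have : K * (b * normc (z t)) <= K * complex.Re (e * z t).
    rewrite ler_wpM2l ?(ltW K0) //; apply: le_trans he.
    by rewrite ler_wpM2r ?normc_ge0.
  by set X := normc (p t - _); lra.
have g_ge0 t : 0 <= g t.
  apply: le_trans (g_ge t); rewrite mulr_ge0 ?normc_ge0 // subr_ge0.
  exact: ltW (approx t).
have [t0 zt0] : exists t, z t != 0.
  apply/existsP; apply: contraNT z0; rewrite negb_exists => /forallP h.
  by apply/eqP/ffunP => t; rewrite ffunE; apply/eqP; have := h t; rewrite negbK.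
have g_gt0 : 0 < \sum_t g t.
  rewrite (bigD1 t0) //= ltr_pwDl ?sumr_ge0 //.
  apply: lt_le_trans (g_ge t0); rewrite mulr_gt0 ?subr_gt0 ?approx //.
  rewrite lt_neqAle normc_ge0 andbT eq_sym; apply: contraNN zt0 => /eqP.
  by move/ComplexField.Normc.eq0_normc => ->.
have -> : \sum_(t in ~: S) `|z t| = (\sum_(t in ~: S) normc (z t))%:C.
  by rewrite rmorph_sum.
have -> : \sum_(t in S) `|z t| = (\sum_(t in S) normc (z t))%:C.
  by rewrite rmorph_sum.
rewrite ltcR -subr_gt0 -(pmulr_rgt0 _ K0).
rewrite -(@pmulr_rgt0 _ (b - alpha)) ?subr_gt0 //.
apply: lt_le_trans g_gt0 _; rewrite /g sumrB -Re_sum dual sub0r.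
rewrite (bigID (mem S)) /=.
rewrite (eq_bigr (fun t => K * (b - alpha) * normc (z t))); last first.
  by move=> t ->; rewrite mul1r.
rewrite [X in _ + X](eq_bigr (fun t => - (K * (b - alpha)) * normc (z t)));
  last first.
  by move=> t /negbTE ->; rewrite mulN1r mulNr.
have -> : \sum_(t in ~: S) normc (z t) = \sum_(t | t \notin S) normc (z t).
  by apply: eq_bigl => t; rewrite inE.
by rewrite -!mulr_sumr; lra.
Qed.

End SamplingPolynomials.

(** * The constant b = 1 - 2 sin(pi / 2 mu), and the final union bound *)

(** Since 1 - 2 sin^2 th = cos(2 th) >= cos(pi / 4) > 1/2 for th = pi / 2n. This makes [b]
    positive. *)
Lemma sin_pi_half_quotient_lt (R : realType) n : (4 <= n)%N ->
  2 * sin (pi / (2 * n%:R)) < 1 :> R.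
Proof.
move=> n4; have nR : 0 < n%:R :> R by rewrite ltr0n (leq_trans _ n4).
set th : R := pi / _.
suff : 1 / 2 < cos (th *+ 2) by rewrite cos_mulr2n cos2sin2; nra.
have th2 : th *+ 2 = pi / n%:R.
  by rewrite /th -mulr_natr; field; rewrite gt_eqF.
have c4 : cos (pi / 4 : R) ^+ 2 = 1 / 2.
  have := cos_mulr2n (pi / 4 : R).
  have -> : pi / 4 *+ 2 = pi / 2 :> R by rewrite -mulr_natr; field.
  by rewrite cos_pihalf; lra.
have c40 : 0 <= cos (pi / 4 : R).
  by apply: cos_ge0_pihalf; have := @pi_gt0 R; lra.
apply: (@lt_le_trans _ _ (cos (pi / 4))); first by nra.
have le4 : pi / n%:R <= pi / 4 :> R.
  by rewrite ler_pM2l ?pi_gt0 // lef_pV2 ?posrE // ler_nat.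
have p0 : 0 <= pi / n%:R :> R by rewrite divr_ge0 ?pi_ge0 // ltW.
have pi0 := @pi_gt0 R.
by rewrite th2 leNgt ltr_cos -?leNgt // in_itv /=; lra.
Qed.

Lemma cos_pi_quotient_ge (R : realType) n : (4 <= n)%N ->
  1 - 2 * sin (pi / (2 * n%:R)) <= cos (pi / n%:R) :> R.
Proof.
move=> n4; have nR : 0 < n%:R :> R by rewrite ltr0n (leq_trans _ n4).
have -> : pi / n%:R = (pi / (2 * n%:R)) *+ 2 :> R.
  by rewrite -mulr_natr; field; rewrite gt_eqF.
have s1 := sin_pi_half_quotient_lt R n4.
have s0 : 0 <= sin (pi / (2 * n%:R)) :> R.
  apply: sin_ge0_pi; rewrite divr_ge0 ?pi_ge0 ?mulr_ge0 //=.
  rewrite ler_pdivrMr ?mulr_gt0 // ler_pMr ?pi_gt0 // -natrM ler1n muln_gt0.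
  by rewrite (leq_trans _ n4).
rewrite cos_mulr2n cos2sin2; nra.
Qed.

Theorem mainTheorem5 (R : realType) (N s : nat) (hN : (1 <= N)%N)
    (hs : (1 <= s)%N) (S : {set 'I_N}) (hS : #|S| = s)
    (C : R) (hC : 0 < C)
    (d : measure_display) (T : measurableType d) (P : probability T R)
    (tau : R) (htau0 : 0 < tau) (htau1 : tau < 1)
    (Omega : T -> {set 'I_N}) (hOmega : random_selection P tau Omega)
    (hsize : tau * N%:R = (3 * s%:R + 2) * C * ln N%:R)
    (mu nu : nat) (hmu : (4 <= mu)%N) (hnu : (4 <= nu)%N)
    (a : R) (ha : a = cos (pi / nu%:R))
    (alpha : R) (halpha : 0 < alpha)
    (hC_alpha : C * a ^+ 2 * (1 - 2 * sin (pi / (2 * mu%:R)))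
                * (1 - 2 * sin (pi / (2 * mu%:R)) - 2 * alpha) = 1) :
  (P [set w | l1_dominated_off R S (Omega w)] >=
   (1 - nu%:R * mu%:R ^+ s * (s%:R + 1)
        * (N%:R `^ (- (C * a ^+ 2 * alpha ^+ 2))))%:E)%E.
Proof.
have [q [q_ge0 q_superset q_law]] := selection_law hOmega.
have -> : [set w | l1_dominated_off R S (Omega w)] =
    [set w | `[< l1_dominated_off R S (Omega w) >]].
  by apply/seteqP; split => w /asboolP.
rewrite (q_law (fun A => `[< l1_dominated_off R S A >])) lee_fin.
(* The total mass is the case of empty [B]; it remains to bound the mass of the sets failing
   (ii). *)
have total : \sum_A q A = 1.
  rewrite -[RHS](expr0 tau) -(@cards0 'I_N) -q_superset.
  by apply: eq_bigl => A; rewrite finset.sub0set.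
rewrite lerBlDr -lerBlDl -{1}total.
rewrite (bigID (fun A => `[< l1_dominated_off R S A >])) /=.
rewrite [X in X - _]addrC addrK.
have NR : 0 < N%:R :> R by rewrite ltr0n.
have SR : 0 < #|S|%:R :> R by rewrite ltr0n hS.
have S0 : (0 < #|S|)%N by rewrite hS.
have mu1 : (1 < mu)%N by exact: leq_trans hmu.
have nu1 : (1 < nu)%N by exact: leq_trans hnu.
pose k0 : 'I_mu := Ordinal (ltnW mu1).
set b := 1 - 2 * _ in hC_alpha.
have b0 : 0 < b by rewrite subr_gt0 sin_pi_half_quotient_lt.
have b1 : b <= cos (pi / mu%:R) by exact: cos_pi_quotient_ge.
have cm1 : cos (pi / mu%:R) <= 1 :> R by exact: cos_le1.
have Ca0 : 0 <= C * a ^+ 2 by rewrite mulr_ge0 ?sqr_ge0 // ltW.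
(* The product of C a^2 b >= 0 and b - 2 alpha is 1, so both factors are positive. *)
have ba : 2 * alpha < b.
  rewrite -subr_gt0 -(@pmulr_rgt0 _ (C * a ^+ 2 * b)) ?hC_alpha //.
  rewrite lt_neqAle mulr_ge0 ?(ltW b0) // andbT; apply/eqP => e.
  by move: hC_alpha; rewrite -e mul0r => /eqP; rewrite eq_sym oner_eq0.
have alb : alpha < b by lra.
pose x t : R := if t \in S then alpha else b - alpha.
have x01 t : 0 <= x t <= 1 by rewrite /x; case: ifP => _; lra.
have K0 : 0 < tau * N%:R by rewrite mulr_gt0.
pose U (f : {ffun 'I_N -> 'I_mu}) := root_pattern R f.
have U1 f s' : ComplexField.Normc.normc (U f s') = 1.
  by rewrite /U /root_pattern -expiX normc_expi.
pose far f t A := tau * N%:R * x t <= ComplexField.Normc.normc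
    (sampling_poly S A (U f) t
     - real_complex R (tau * N%:R) * restrict_to S (U f) t).
(* If (ii) fails, some pattern and some point are [far]. The conjunct [true] gives the index the
   shape that [pair_big] splits into a double sum. *)
apply: le_trans (sum_le_cover q_ge0
  (K := fun ft : {ffun 'I_N -> 'I_mu} * 'I_N =>
     (ft.1 \in pffun_on k0 (mem S) predT) && true)
  (Q := fun ft A => far ft.1 ft.2 A) _) _.
  move=> A /asboolP bad; apply: contrapT => good; apply: bad.
  apply: (l1_dominated_off_of_interpolation (k0 := k0) hN mu1 K0 b1 alb).
  move=> f t fS; rewrite ltNge; apply/negP => le; apply: good.
  by exists (f, t); rewrite //= fS.
rewrite -(pair_big (fun f => f \in pffun_on k0 (mem S) predT) xpredT
  (fun f t => \sum_(A | far f t A) q A)) /=.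
pose e (y : R) := N%:R `^ (- (C * a ^+ 2 * y ^+ 2)).
have tail f t : \sum_(A | far f t A) q A
    <= nu%:R * e (x t).
  apply: le_trans (sampling_poly_tail q_ge0 q_superset htau0 (ltW htau1) hN t
    S0 (U1 f) nu1 (x01 t)) _.
  (* The exponent (3s + 2) C a^2 x^2 log N / (3s) is at least C a^2 x^2 log N. *)
  rewrite ler_wpM2l // /e /powR gt_eqF // ler_expR -ha hsize hS mulNr lerN2.
  rewrite ler_pdivlMr ?mulr_gt0 ?ltr0n // exprMn.
  set l := ln N%:R; have l0 : 0 <= l by rewrite ln_ge0 // ler1n.
  suff : 0 <= C * a ^+ 2 * x t ^+ 2 * l by lra.
  by rewrite mulr_ge0 // mulr_ge0 ?sqr_ge0.
have inner f : \sum_t \sum_(A | far f t A) q A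
    <= nu%:R * ((s%:R + 1) * e alpha).
  apply: le_trans (ler_sum _ (fun t _ => tail f t)) _.
  rewrite -mulr_sumr ler_wpM2l // (bigID (mem S)) /= mulrDl mul1r lerD //.
    rewrite (eq_bigr (fun=> e alpha)) => [|t tS]; last by rewrite /x tS.
    by rewrite sumr_const hS mulr_natl.
  rewrite (eq_bigr (fun=> e (b - alpha))) => [|t /negbTE tS]; last first.
    by rewrite /x tS.
  (* Indeed C a^2 (b - alpha)^2 = C a^2 b (b - 2 alpha) + C a^2 alpha^2, whose first term is 1. *)
  have -> : e alpha = N%:R * e (b - alpha).
    rewrite -[X in X * e _]powRr1 ?(ltW NR) // -powRD; last first.
      by rewrite (gt_eqF NR) implybT.
    by rewrite /e -hC_alpha; congr powR; ring.
  rewrite sumr_const mulr_natl ler_wpMn2l ?powR_ge0 //.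
  by rewrite (leq_trans (max_card _)) // card_ord.
apply: le_trans (ler_sum _ (fun f _ => inner f)) _.
rewrite sumr_const card_pffun_on card_ord hS -[leLHS]mulr_natl natrX /e.
by rewrite le_eqVlt; apply/orP; left; apply/eqP; ring.
Qed.
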